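(* Let $K\subsetneq 2^{[n]}$ be a proper simplicial complex such that $\mathrm{Vert}(K)=[n]$. Then $K$ is a threshold complex (equivalently, $\Gamma = 2^{[n]}\setminus K$ is a weighted majority game with all weights strictly positive) if and only if the canonical fan $Fan(K)$ of $K$ is polytopal.
   Context: Notation: $[n]=\{1,\dots,n\}$. A simplicial complex $K\subseteq 2^{[n]}$ is a family of subsets with $\emptyset\in K$ that is closed under taking subsets; it is proper if $K\neq 2^{[n]}$. The condition $\mathrm{Vert}(K)=[n]$ means $\{i\}\in K$ for every $i\in[n]$ (there are no ghost vertices). $K$ is a threshold complex if there are strictly positive real weights $w=(w_1,\dots,w_n)$ and a real number $q$ (the quota) such that $K=Tr_{w<q}:=\{A\subseteq[n] : w(A)<q\}$, where $w(A)=\sum_{i\in A}w_i$. Equivalently $\Gamma=2^{[n]}\setminus K=\{A : w(A)\geq q\}$ is a weighted majority game with strictly positive weights (its members are the winning coalitions). The Alexander dual of $K$ is $K^\circ=\{A\subseteq[n] : [n]\setminus A\notin K\}$. The canonical fan $Fan(K)=Fan(\Gamma)$ lives in $H_0=\{x\in\mathbb{R}^n : x_1+\dots+x_n=0\}$. Put $\delta_i=e_i-\frac1n(e_1+\dots+e_n)$ and $\bar\delta_i=-\delta_i$ for $i\in[n]$. The cones of $Fan(K)$ are exactly the cones generated by $\{\delta_i : i\in A_1\}\cup\{\bar\delta_j : j\in A_2\}$ over all pairs $(A_1,A_2)$ with $A_1\in K$, $A_2\in K^\circ$, $A_1\cap A_2=\emptyset$. It is known that this is a complete simplicial fan in $H_0$.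 A fan in $H_0$ is polytopal if it is the (outer) normal fan of a convex polytope in $H_0$ (with $H_0$ identified with its dual by the standard inner product). *)

(* Defs.v *)
From mathcomp Require Import all_boot all_order all_algebra.
From mathcomp Require Import boolp classical_sets functions cardinality reals.

Set Implicit Arguments.
Unset Strict Implicit.
Unset Printing Implicit Defensive.

Import Order.TTheory GRing.Theory Num.Theory.

Local Open Scope classical_set_scope.
Local Open Scope ring_scope.

(* The vertex set [n] is represented by 'I_n, and R^n by 'rV[R]_n. Finite sets
   of vertices use %SET; subsets of R^n and fans (sets of subsets of R^n) are
   classical sets. *)

Definition simplicial_complex (n : nat) (K : {set {set 'I_n}}) : Prop :=
  finset.set0 \in K /\ forall A B : {set 'I_n}, B \in K -> A \subset B -> A \in K.

Definition weight (R : realType) (n : nat) (w : 'I_n -> R) (A : {set 'I_n}) : R :=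
  \sum_(i in A) w i.

Definition threshold_complex (R : realType) (n : nat)
    (K : {set {set 'I_n}}) : Prop :=
  exists (w : 'I_n -> R) (q : R), (forall i, 0 < w i) /\
    K = [set A : {set 'I_n} | weight w A < q]%SET.

(* G is the family of winning coalitions. *)
Definition weighted_majority_game (R : realType) (n : nat)
    (G : {set {set 'I_n}}) : Prop :=
  exists (w : 'I_n -> R) (q : R), (forall i, 0 < w i) /\
    G = [set A : {set 'I_n} | q <= weight w A]%SET.

Definition alexander_dual (n : nat) (K : {set {set 'I_n}}) : {set {set 'I_n}} :=
  [set A : {set 'I_n} | (~: A)%SET \notin K]%SET.

Section Fans.
Variables (R : realType) (n : nat).
Local Notation V := 'rV[R]_n.

Definition dot (u v : V) : R := \sum_(i < n) u 0 i * v 0 i.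

Definition H0 : set V := [set x | \sum_(i < n) x 0 i = 0].

Definition delta (i : 'I_n) : V :=
  delta_mx 0 i - n%:R^-1 *: \sum_(j < n) delta_mx 0 j.

Definition deltabar (i : 'I_n) : V := - delta i.

(* Taking m = 0, the cone generated by the empty set is {0}. *)
Definition cone_hull (G : set V) : set V :=
  [set x | exists (m : nat) (v : 'I_m -> V) (c : 'I_m -> R),
     [/\ forall k, G (v k), forall k, 0 <= c k & x = \sum_(k < m) c k *: v k]].

Definition conv_hull (G : set V) : set V :=
  [set x | exists (m : nat) (v : 'I_m -> V) (c : 'I_m -> R),
     [/\ forall k, G (v k), forall k, 0 <= c k, \sum_(k < m) c k = 1
       & x = \sum_(k < m) c k *: v k]].

Definition canonical_fan (K : {set {set 'I_n}}) : set (set V) :=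
  [set C | exists A1 A2 : {set 'I_n},
     [/\ A1 \in K, A2 \in alexander_dual K, (A1 :&: A2)%SET = finset.set0
       & C = cone_hull (delta @` [set` A1] `|` deltabar @` [set` A2])]].

Definition polytope (P : set V) : Prop :=
  exists2 S : set V, finite_set S & P = conv_hull S.

(* The subset of P on which the linear functional dot u is maximal. *)
Definition max_face (P : set V) (u : V) : set V :=
  [set x | P x /\ forall y, P y -> dot u y <= dot u x].

(* Nonempty faces, P itself included (u = 0). *)
Definition is_face (P F : set V) : Prop :=
  F !=set0 /\ exists2 u, H0 u & F = max_face P u.

Definition normal_cone (P F : set V) : set V :=
  [set u | H0 u /\ F `<=` max_face P u].

Definition normal_fan (P : set V) : set (set V) :=
  [set normal_cone P F | F in [set F | is_face P F]].

Definition polytopal (Fan : set (set V)) : Prop :=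
  exists P : set V, [/\ polytope P, P `<=` H0 & Fan = normal_fan P].

End Fans.

(* Main.v *)
Require Import Defs.
From mathcomp Require Import all_boot all_order all_algebra.
From mathcomp Require Import boolp classical_sets reals.
From mathcomp Require Import cardinality ring lra.

(* If K = {A : w(A) < q} with no w(A) equal to q, then Fan(K) is the normal fan
   of the hyperplane section {0 <= y_i <= w_i, y_1 + ... + y_n = q} of a box,
   translated into H_0 by y_i = x_i + q/n.  A functional u is maximal on the face
   where y_i = w_i for u_i > t and y_i = 0 for u_i < t, with t the q-quantile of
   the coordinates of u.

   Conversely, let x_i range over [-b_i, a_i] on a polytope P with normal fan
   Fan(K); put w_i = a_i + b_i and q = b_1 + ... + b_n, so that the numbers
   x_i + b_i in [0, w_i] sum to q on P.  A point x of P maximal for the cone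
   (A_1, A_2) gives w(A_1) <= q <= w([n] \ A_2). *)

Set Implicit Arguments.
Unset Strict Implicit.
Unset Printing Implicit Defensive.

Import Order.TTheory GRing.Theory Num.Theory.

Local Open Scope classical_set_scope.
Local Open Scope ring_scope.

(** * Conic and convex combinations *)

Section Hulls.
Variables (R : realType) (n : nat).
Local Notation V := 'rV[R]_n.
Implicit Types (G : set V) (x y u : V).

(** Concatenation of finite families, by which two finite combinations are merged into one. *)
Definition join_fun (T : Type) m1 m2 (f : 'I_m1 -> T) (g : 'I_m2 -> T)
    (k : 'I_(m1 + m2)) : T :=
  match fintype.split k with inl i => f i | inr j => g j end.

Lemma join_funl (T : Type) m1 m2 (f : 'I_m1 -> T) (g : 'I_m2 -> T) i :
  join_fun f g (lshift m2 i) = f i.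
Proof. by rewrite /join_fun (unsplitK (inl i)). Qed.

Lemma join_funr (T : Type) m1 m2 (f : 'I_m1 -> T) (g : 'I_m2 -> T) j :
  join_fun f g (rshift m1 j) = g j.
Proof. by rewrite /join_fun (unsplitK (inr j)). Qed.

Lemma join_fun_ind (T : Type) (Q : T -> Prop) m1 m2
    (f : 'I_m1 -> T) (g : 'I_m2 -> T) :
  (forall i, Q (f i)) -> (forall j, Q (g j)) -> forall k, Q (join_fun f g k).
Proof. by move=> Qf Qg k; rewrite /join_fun; case: fintype.split. Qed.

Lemma sum_join_fun m1 m2 (v1 : 'I_m1 -> V) (v2 : 'I_m2 -> V)
    (c1 : 'I_m1 -> R) (c2 : 'I_m2 -> R) :
  \sum_k join_fun c1 c2 k *: join_fun v1 v2 k =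
  \sum_i c1 i *: v1 i + \sum_j c2 j *: v2 j.
Proof.
rewrite big_split_ord /=; congr (_ + _); apply: eq_bigr => i _.
  by rewrite !join_funl.
by rewrite !join_funr.
Qed.

Lemma cone_hull0 G : cone_hull G 0.
Proof.
exists 0, (fun=> 0), (fun=> 0); split => //; first by case.
by rewrite big_ord0.
Qed.

Lemma cone_hullD G x y : cone_hull G x -> cone_hull G y -> cone_hull G (x + y).
Proof.
move=> [m1 [v1 [c1 [Gv1 c1_ge0 ->]]]] [m2 [v2 [c2 [Gv2 c2_ge0 ->]]]].
exists (m1 + m2)%N, (join_fun v1 v2), (join_fun c1 c2); split.
- exact: join_fun_ind.
- exact: (join_fun_ind (Q := fun c => 0 <= c)).
- by rewrite sum_join_fun.
Qed.

Lemma cone_hull_scale G x c : 0 <= c -> G x -> cone_hull G (c *: x).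
Proof.
by move=> c_ge0 Gx; exists 1, (fun=> x), (fun=> c); rewrite big_ord1.
Qed.

Lemma sub_conv_hull G : G `<=` conv_hull G.
Proof.
move=> x Gx; exists 1, (fun=> x), (fun=> 1).
by rewrite !big_ord1 scale1r; split.
Qed.

Lemma conv_hull_convex G x y a b : 0 <= a -> 0 <= b -> a + b = 1 ->
  conv_hull G x -> conv_hull G y -> conv_hull G (a *: x + b *: y).
Proof.
move=> a_ge0 b_ge0 ab [m1 [v1 [c1 [Gv1 c1_ge0 c1_1 ->]]]].
move=> [m2 [v2 [c2 [Gv2 c2_ge0 c2_1 ->]]]].
exists (m1 + m2)%N, (join_fun v1 v2).
exists (join_fun (fun i => a * c1 i) (fun j => b * c2 j)); split.
- exact: join_fun_ind.
- by apply: (join_fun_ind (Q := fun c => 0 <= c)) => i; rewrite mulr_ge0.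
- rewrite big_split_ord /=.
  under eq_bigr do rewrite join_funl.
  under [X in _ + X]eq_bigr do rewrite join_funr.
  by rewrite -!mulr_sumr c1_1 c2_1 !mulr1.
- rewrite sum_join_fun !scaler_sumr.
  by congr (_ + _); apply: eq_bigr => i _; rewrite scalerA.
Qed.

End Hulls.

(** * The cones of the canonical fan, described by inequalities *)

Section CanonicalCones.
Variables (R : realType) (n : nat).
Local Notation V := 'rV[R]_n.
Implicit Types (x y u : V) (A : {set 'I_n}) (K : {set {set 'I_n}}).

Lemma deltaE (i j : 'I_n) : delta R i 0 j = (j == i)%:R - n%:R^-1.
Proof.
rewrite !mxE eqxx /= summxE (bigD1 j) //= big1 => [|k /negPf jk].
  by rewrite !mxE !eqxx addr0 mulr1.
by rewrite mxE eqxx eq_sym jk.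
Qed.

Lemma deltabarE (i j : 'I_n) : deltabar R i 0 j = - delta R i 0 j.
Proof. by rewrite [LHS]mxE. Qed.

Lemma sum_eq_ord (i : 'I_n) (f : 'I_n -> R) : \sum_j (j == i)%:R * f j = f i.
Proof.
rewrite (bigD1 i) //= eqxx mul1r big1 ?addr0 // => j /negPf ->.
by rewrite mul0r.
Qed.

Lemma H0_delta (i : 'I_n) : H0 (delta R i).
Proof.
rewrite /H0 /=; under eq_bigr do rewrite deltaE.
rewrite big_split /= sumr_const card_ord -[_ *+ n]mulr_natr mulNr mulVf; last first.
  by rewrite pnatr_eq0 -lt0n (leq_ltn_trans _ (ltn_ord i)).
under eq_bigr do rewrite -[_%:R]mulr1.
by rewrite (sum_eq_ord i (fun=> 1)) subrr.
Qed.

Lemma H0D x y : H0 x -> H0 y -> H0 (x + y).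
Proof.
rewrite /H0 /= => Hx Hy; under eq_bigr do rewrite mxE.
by rewrite big_split /= Hx Hy addr0.
Qed.

Lemma H0Z c x : H0 x -> H0 (c *: x).
Proof.
by rewrite /H0 /= => Hx; under eq_bigr do rewrite mxE; rewrite -mulr_sumr Hx mulr0.
Qed.

Lemma H0_deltabar (i : 'I_n) : H0 (deltabar R i).
Proof. by rewrite /deltabar -scaleN1r; apply/H0Z/H0_delta. Qed.

(** Constant vectors are orthogonal to H_0, so a functional on H_0 may be measured from any level
    t. *)
Lemma dot_shift t u x : H0 x -> dot u x = \sum_i (u 0 i - t) * x 0 i.
Proof.
rewrite /H0 /= => Hx; under [RHS]eq_bigr do rewrite mulrBl.
by rewrite sumrB -mulr_sumr Hx mulr0 subr0.
Qed.

Lemma dot_delta (i : 'I_n) x : H0 x -> dot (delta R i) x = x 0 i.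
Proof.
move=> /(dot_shift (- n%:R^-1)) ->.
by under eq_bigr do rewrite deltaE opprK subrK; rewrite sum_eq_ord.
Qed.

Lemma dot_deltabar (i : 'I_n) x : H0 x -> dot (deltabar R i) x = - x 0 i.
Proof.
move=> Hx; rewrite -(dot_delta i Hx) /dot -sumrN.
by apply: eq_bigr => j _; rewrite deltabarE mulNr.
Qed.

(** Every delta_i is constant off the coordinate i, so a combination of generators takes a common
    value t off A1 and A2, lies above t on A1 and below t on A2. *)
Definition level_cone A1 A2 (t : R) u : Prop :=
  forall i, [/\ i \in A1 -> t <= u 0 i, i \in A2 -> u 0 i <= t
    & i \notin A1 -> i \notin A2 -> u 0 i = t].

(** For u in H_0 and disjoint A1, A2 this is the relative interior of the cone; such functionals cut
    out exactly the face that belongs to the cone. *)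
Definition strict_level_cone A1 A2 (t : R) u : Prop :=
  forall i, [/\ i \in A1 -> t < u 0 i, i \in A2 -> u 0 i < t
    & i \notin A1 -> i \notin A2 -> u 0 i = t].

Lemma strict_level_coneW A1 A2 t u :
  strict_level_cone A1 A2 t u -> level_cone A1 A2 t u.
Proof. by move=> + i => /(_ i)[h1 h2 h3]; split=> [/h1/ltW|/h2/ltW|]. Qed.

Lemma exists_strict_level_cone A1 A2 : (A1 :&: A2 = finset.set0)%SET ->
  exists t, exists2 u : V, H0 u & strict_level_cone A1 A2 t u.
Proof.
(* The values 1 on A1, -1 on A2 and 0 elsewhere separate strictly; subtracting their mean projects
   to H_0 and moves the level 0 to minus the mean. *)
move=> dis; pose f i : R := (i \in A1)%:R - (i \in A2)%:R.
exists (- (n%:R^-1 * \sum_i f i)), (\row_i (f i - n%:R^-1 * \sum_i f i)).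
  rewrite /H0 /=; under eq_bigr do rewrite mxE.
  rewrite sumrB sumr_const card_ord -[_ *+ n]mulr_natl mulrA.
  case: (posnP n) => [n0|n_gt0]; last by rewrite mulfV ?mul1r ?subrr // pnatr_eq0 -lt0n.
  rewrite big1 ?mulr0 ?subr0 // => i.
  by have := ltn_ord i; rewrite [X in (_ < X)%N]n0.
move=> i; rewrite mxE /f; split.
- move=> iA1; rewrite iA1; have /negPf -> : i \notin A2.
    by apply/negP => iA2; move/finset.setP/(_ i): dis; rewrite !inE iA1 iA2.
  by rewrite ltrDr subr0 ltr01.
- move=> iA2; rewrite iA2; have /negPf -> : i \notin A1.
    by apply/negP => iA1; move/finset.setP/(_ i): dis; rewrite !inE iA1 iA2.
  by rewrite gtrDr sub0r ltrN10.
- by move=> /negPf -> /negPf ->; rewrite subrr add0r.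
Qed.

Definition fan_cone A1 A2 : set V :=
  cone_hull (@delta R n @` [set` A1] `|` @deltabar R n @` [set` A2]).

(** Levels add under sums of vectors, and the multiples c delta_i and c deltabar_i have levels -c/n
    and c/n. Conversely the numbers u_i - t serve as coefficients of the delta_i, with the right
    sign on A1 and on A2 and zero elsewhere. *)
Lemma fan_coneP A1 A2 u : (A1 :&: A2 = finset.set0)%SET ->
  fan_cone A1 A2 u <-> H0 u /\ exists t, level_cone A1 A2 t u.
Proof.
move=> dis; have notin2 i : i \in A1 -> i \in A2 -> False.
  by move=> iA1 iA2; move/finset.setP/(_ i): dis; rewrite !inE iA1 iA2.
split.
  move=> [m [v [c [Gv c_ge0 ->]]]].
  apply: (big_ind (fun u => H0 u /\ exists t, level_cone A1 A2 t u)).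
  - split; first by rewrite /H0 /= big1 // => i _; rewrite mxE.
    by exists 0 => i; rewrite mxE; split.
  - move=> x y [Hx [s xs]] [Hy [t yt]]; split; first exact: H0D.
    exists (s + t) => i; rewrite mxE.
    have [x1 x2 x3] := xs i; have [y1 y2 y3] := yt i.
    split => [iA|iA|iA1 iA2]; [exact: lerD (x1 _) (y1 _)
      |exact: lerD (x2 _) (y2 _)|by rewrite x3 ?y3].
  move=> k _; have [[i iA <-]|[i iA <-]] := Gv k.
    split; first exact/H0Z/H0_delta.
    exists (c k * - n%:R^-1) => j; rewrite mxE deltaE.
    split => [_|jA|jA _].
    + by rewrite ler_wpM2l // lerDr ler0n.
    + by case: eqVneq jA => [->/(notin2 _ iA)|_ _] //; rewrite add0r.
    + by case: eqVneq jA => [->|]; [rewrite iA | rewrite add0r].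
  split; first exact/H0Z/H0_deltabar.
  exists (c k * n%:R^-1) => j.
  rewrite mxE deltabarE deltaE opprB.
  split => [jA|_|_ jA].
  + by case: eqVneq jA => [->/notin2/(_ iA)|_ _] //; rewrite subr0.
  + by rewrite ler_wpM2l // gerBl ler0n.
  + by case: eqVneq jA => [->|]; [rewrite iA | rewrite subr0].
move=> [Hu [t ut]].
(* In H_0 one has u = sum u_i delta_i, and the delta_i sum to zero, so t can be subtracted from all
   coefficients. *)
have -> : u = \sum_i (u 0 i - t) *: delta R i.
  apply/rowP => j; rewrite summxE.
  under eq_bigr do rewrite mxE deltaE mulrBr.
  rewrite sumrB -mulr_suml sumrB Hu sumr_const card_ord sub0r.
  under eq_bigr do rewrite eq_sym mulrC.
  rewrite sum_eq_ord mulNr -[t *+ n]mulr_natr mulfK ?opprK ?subrK //.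
  by rewrite pnatr_eq0 -lt0n (leq_ltn_trans _ (ltn_ord j)).
apply: big_ind => [|x y|i _]; [exact: cone_hull0|exact: cone_hullD|].
have [u1 u2 u3] := ut i.
have [iA1|iA1] := boolP (i \in A1).
  by apply: cone_hull_scale; [rewrite subr_ge0 u1 | left; exists i].
have [iA2|iA2] := boolP (i \in A2).
  rewrite -[delta R i]opprK scalerN -scaleNr.
  by apply: cone_hull_scale; [rewrite oppr_ge0 subr_le0 u2 | right; exists i].
by rewrite u3 // subrr scale0r; apply: cone_hull0.
Qed.

End CanonicalCones.

(** * From a polytope to weights and a quota *)

Section PolytopalThreshold.
Variables (R : realType) (n : nat) (K : {set {set 'I_n}}).
Hypothesis K_sub : forall A B : {set 'I_n}, B \in K -> A \subset B -> A \in K.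
Hypotheses (K0 : finset.set0 \in K) (KT : finset.setT \notin K).
Hypothesis K_vert : forall i : 'I_n, [set i]%SET \in K.
Variable P : set 'rV[R]_n.
Hypotheses (PH0 : P `<=` @H0 R n) (fanP : canonical_fan (R := R) K = normal_fan P).

Lemma dual0 : finset.set0 \in alexander_dual K.
Proof. by rewrite inE finset.setC0. Qed.

Lemma fan_cone_face (A1 A2 : {set 'I_n}) : A1 \in K -> A2 \in alexander_dual K ->
    (A1 :&: A2 = finset.set0)%SET ->
  exists F, F !=set0 /\ normal_cone P F = fan_cone A1 A2.
Proof.
move=> A1K A2K dis.
have : canonical_fan (R := R) K (fan_cone A1 A2) by exists A1, A2.
by rewrite fanP => -[F [F0 _] <-]; exists F.
Qed.

(** The generators of the cone are maximal on F, and on H_0 the functionals delta_i and deltabar_i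
    are the coordinate x_i and its negative. *)
Lemma fan_cone_max (A1 A2 : {set 'I_n}) : A1 \in K -> A2 \in alexander_dual K ->
    (A1 :&: A2 = finset.set0)%SET ->
  exists F, [/\ F !=set0, normal_cone P F = fan_cone A1 A2
    & forall v, F v -> [/\ P v,
        forall i, i \in A1 -> forall y, P y -> y 0 i <= v 0 i
      & forall i, i \in A2 -> forall y, P y -> v 0 i <= y 0 i]].
Proof.
move=> A1K A2K dis; have [F [F0 ncF]] := fan_cone_face A1K A2K dis.
exists F; split => // v Fv.
have maxv u : fan_cone A1 A2 u -> max_face P u v by rewrite -ncF => -[_]; apply.
have Pv : P v.
  (* The zero functional lies in every cone, and its maximal face is P. *)
  by have [] := maxv 0 (cone_hull0 _).
split => // i iA y Py.
  have [|_ /(_ y Py)] := maxv (delta R i).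
    by rewrite -[delta R i]scale1r; apply: cone_hull_scale => //; left; exists i.
  by rewrite !dot_delta //; exact: PH0.
have [|_ /(_ y Py)] := maxv (deltabar R i).
  by rewrite -[deltabar R i]scale1r; apply: cone_hull_scale => //; right; exists i.
by rewrite !dot_deltabar ?lerN2 //; exact: PH0.
Qed.

(** Since there are no ghost vertices, the ray of delta_i is a cone of the fan, and its face attains
    the maximum of x_i. *)
Lemma exists_upper : exists a : 'I_n -> R, forall i,
  (exists2 v, P v & v 0 i = a i) /\ forall y, P y -> y 0 i <= a i.
Proof.
suff /choice[a aP] : forall i, exists ai, (exists2 v, P v & v 0 i = ai) /\
    forall y, P y -> y 0 i <= ai by exists a.
move=> i.
have [|F [[v Fv] _ /(_ v Fv)[Pv vmax _]]] := fan_cone_max (K_vert i) dual0.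
  by rewrite finset.setI0.
by exists (v 0 i); split => [|y Py]; [exists v | apply: vmax Py; rewrite inE].
Qed.

(* If [n] \ {i} lies in K then deltabar_i is not a ray of the fan, so that the
   facet -x_i <= b_i may be moved off P; this slack is what makes the
   inequality w(A) < q strict for A = [n] \ {i}. *)
Lemma exists_lower : exists b : 'I_n -> R, forall i,
  if [set i]%SET \in alexander_dual K
  then (exists2 v, P v & v 0 i = - b i) /\ forall y, P y -> - b i <= y 0 i
  else forall y, P y -> - b i < y 0 i.
Proof.
have [a aP] := exists_upper.
suff /choice[b bP] : forall i, exists bi, if [set i]%SET \in alexander_dual K
    then (exists2 v, P v & v 0 i = - bi) /\ forall y, P y -> - bi <= y 0 i
    else forall y, P y -> - bi < y 0 i by exists b.
move=> i; case: (boolP ([set i]%SET \in alexander_dual K)) => iK.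
  have [|F [[v Fv] _ /(_ v Fv)[Pv _ vmin]]] := fan_cone_max K0 iK.
    by rewrite finset.set0I.
  exists (- v 0 i); rewrite opprK; split => [|y Py]; first by exists v.
  by apply: vmin Py; rewrite inE.
(* On H_0 the coordinate x_i is minus the sum of the others, hence at least minus the sum of their
   upper bounds; the extra 1 gives the slack. *)
exists (\sum_(j | j != i) a j + 1) => y Py.
have /eqP := PH0 Py; rewrite (bigD1 i) //= addr_eq0 => /eqP ->.
rewrite ltrN2 (le_lt_trans (y := \sum_(j | j != i) a j)) ?ltrDl //.
by apply: ler_sum => j _; have [_] := aP j; apply.
Qed.

Lemma polytopal_threshold : threshold_complex R K.
Proof.
have [a aP] := exists_upper; have [b bP] := exists_lower.
have a_ub i y : P y -> y 0 i <= a i by have [_] := aP i; apply.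
have b_lb i y : P y -> - b i <= y 0 i.
  by move=> Py; have := bP i; case: ifP => [_ [_]|_ /(_ y Py)/ltW]; [apply|].
have a_tight i v : P v -> (forall y, P y -> y 0 i <= v 0 i) -> v 0 i = a i.
  move=> Pv vmax; apply/le_anti; rewrite a_ub //=.
  by have [[y Py <-] _] := aP i; apply: vmax.
have b_tight i v : [set i]%SET \in alexander_dual K -> P v ->
    (forall y, P y -> v 0 i <= y 0 i) -> v 0 i = - b i.
  move=> iK Pv vmin; apply/le_anti; rewrite b_lb // andbT.
  by have := bP i; rewrite iK => -[[y Py <-] _]; apply: vmin.
pose w i := a i + b i; pose q := \sum_i b i.
have sumq v : P v -> \sum_i (v 0 i + b i) = q.
  by move=> Pv; rewrite big_split /= (PH0 Pv) add0r.
have v_split (A : {set 'I_n}) v : P v -> \sum_(i in A) (v 0 i + b i) +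
    \sum_(i in (~: A)%SET) (v 0 i + b i) = q.
  move=> Pv; rewrite -(sumq v Pv) [RHS](bigID (mem A)) /=.
  by congr (_ + _); apply: eq_bigl => i; rewrite inE.
have b_pos v i : P v -> 0 <= v 0 i + b i.
  by move=> Pv; rewrite -lerBlDr sub0r b_lb.
(* If w_i = 0, then x_i is constant on P, so delta_i lies in every normal cone, in particular in the
   cone {0} of the pair of empty sets. Then delta_i has equal coordinates, which forces [n] = {i}, a
   member of K. *)
have w_gt0 i : 0 < w i.
  have [|F [[v Fv] ncF Fmax]] := fan_cone_max K0 dual0.
    by rewrite finset.set0I.
  have Pv : P v by have [] := Fmax v Fv.
  rewrite lt_neqAle; apply/andP; split; last first.
    by have := a_ub i v Pv; have := b_lb i v Pv; rewrite /w; lra.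
  apply/eqP => w0.
  have constP y : P y -> y 0 i = a i.
    move=> Py; apply/le_anti; rewrite a_ub //= (le_trans _ (b_lb i y Py)) //.
    by rewrite -subr_le0 opprK -/(w i) -w0.
  have : fan_cone (R := R) finset.set0 finset.set0 (delta R i).
    rewrite -ncF; split; first exact: H0_delta.
    move=> x /Fmax[Px _ _]; split=> // y Py.
    by rewrite !dot_delta ?constP //; exact: PH0.
  rewrite fan_coneP ?finset.setI0 // => -[_ [t ut]].
  have all1 j : j = i.
    have [_ _] := ut i; have [_ _] := ut j; rewrite !inE !deltaE eqxx.
    move=> /(_ isT isT) <- /(_ isT isT) /addIr/eqP.
    by case: (j =P i) => //; rewrite oner_eq0.
  move: KT; have -> : [set: 'I_n]%SET = [set i]%SET.
    by apply/finset.setP => j; rewrite !inE (all1 j) eqxx.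
  by rewrite K_vert.
exists w, q; split => //; apply/finset.setP => A; rewrite inE.
apply/idP/idP => [AK|]; last first.
  apply: contraLR => AK; rewrite -leNgt.
  (* For A outside K, the face of the pair (empty set, [n] \ A) has x_i = -b_i off A; only A then
     contributes to the sum q, at most w(A). *)
  have dA : (~: A)%SET \in alexander_dual K by rewrite inE finset.setCK.
  have [|F [[v Fv] _ /(_ v Fv)[Pv _ vmin]]] := fan_cone_max K0 dA.
    by rewrite finset.set0I.
  rewrite -(v_split A v Pv) [X in _ + X]big1 ?addr0.
    by apply: ler_sum => i _; rewrite lerD2r a_ub.
  move=> i iA; rewrite (b_tight i v) ?addNr // ?inE; last by apply: vmin.
  (* The bound b_i is attained: otherwise [n] \ {i} would be in K, and so would its subset A. *)
  rewrite inE in iA; apply: contra AK => iK; apply: K_sub iK _.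
  by apply/fintype.subsetP => j jA; rewrite !inE; apply: contraNneq iA => <-.
have [|F [[v Fv] ncF Fmax]] := fan_cone_max AK dual0.
  by rewrite finset.setI0.
have sumA x : F x -> weight w A + \sum_(i in (~: A)%SET) (x 0 i + b i) = q.
  move=> /Fmax[Px xmax _]; rewrite -(v_split A x Px); congr (_ + _).
  by apply: eq_bigr => i iA; rewrite (a_tight i x) //; apply: xmax.
have wA_le : weight w A <= q.
  have [Pv _ _] := Fmax v Fv.
  by rewrite -(sumA v Fv) lerDl sumr_ge0 // => i _; apply: b_pos.
(* Suppose w(A) = q. On the face of (A, empty set) the nonnegative terms x_i + b_i off A then sum to
   zero, so x_i is minimal there and deltabar_i belongs to the cone. *)
rewrite lt_neqAle wA_le andbT; apply/eqP => wAq.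
have zero x i : F x -> i \notin A -> x 0 i = - b i.
  move=> Fx iA; have [Px _ _] := Fmax x Fx.
  have /eqP := sumA x Fx; rewrite wAq -subr_eq0 addrC addKr.
  rewrite psumr_eq0 => [|j _]; last exact: b_pos.
  by move=> /allP/(_ i); rewrite mem_index_enum inE iA /= addr_eq0 => /(_ isT)/eqP.
have ray i : i \notin A -> fan_cone (R := R) A finset.set0 (deltabar R i).
  move=> iA; rewrite -ncF; split; first exact: H0_deltabar.
  move=> x Fx; have [Px _ _] := Fmax x Fx; split => // y Py.
  by rewrite !dot_deltabar ?lerN2 ?(zero x) ?b_lb //; exact: PH0.
have [i iA] : exists i, i \notin A.
  apply/existsP; apply: contraNT KT; rewrite negb_exists => /forallP AT.
  rewrite -(_ : A = finset.setT) //; apply/finset.setP => i.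
  by rewrite inE; have := AT i; rewrite negbK.
(* A second index j off A is impossible: vectors of the cone agree at i and j, while deltabar_i does
   not. *)
have AE : A = (~: [set i])%SET.
  apply/finset.setP => j; rewrite !inE; apply/idP/idP => [|ji].
    by apply: contraTneq => ->.
  apply: contraT => jA.
  have := ray i iA; rewrite fan_coneP ?finset.setI0 // => -[_ [t ut]].
  have [_ _ /(_ iA)] := ut i; have [_ _ /(_ jA)] := ut j.
  rewrite !inE => /(_ isT) <- /(_ isT) /eqP.
  rewrite !deltabarE !deltaE eqxx (negPf ji) eqr_opp.
  by move=> /eqP/addIr/eqP; rewrite oner_eq0.
have [Pv _ _] := Fmax v Fv.
(* Now [n] \ {i} = A is in K, so -b_i was chosen strictly below x_i on P, yet v attains it. *)
have := bP i; rewrite inE -AE AK /= => /(_ v Pv).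
by rewrite (zero v i) // ltxx.
Qed.

End PolytopalThreshold.

(** * The box slice as a polytope *)

Section ThresholdPolytopal.
Variables (R : realType) (n : nat) (w : 'I_n -> R) (c : R).
Hypothesis w_gt0 : forall i, 0 < w i.
Implicit Types (A : {set 'I_n}) (x u z : 'rV[R]_n).

(** The constant [c] stands for q/n, so that the numbers x_i + c sum to q. *)
Definition box_slice : set 'rV[R]_n :=
  [set x | H0 x /\ forall i, 0 <= x 0 i + c <= w i].

Definition inner x : {set 'I_n} := [set i | 0 < x 0 i + c < w i]%SET.

Lemma box_lo x i : box_slice x -> 0 <= x 0 i + c.
Proof. by move=> [_ /(_ i)/andP[]]. Qed.

Lemma box_hi x i : box_slice x -> x 0 i + c <= w i.
Proof. by move=> [_ /(_ i)/andP[]]. Qed.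

Definition shift_along (s : R) (i j : 'I_n) x : 'rV[R]_n :=
  x + s *: (delta_mx 0 i - delta_mx 0 j).

Lemma shift_alongE s i j x k :
  shift_along s i j x 0 k = x 0 k + s * ((k == i)%:R - (k == j)%:R).
Proof. by rewrite !mxE. Qed.

Lemma dot_shift_along s i j x u :
  dot u (shift_along s i j x) = dot u x + s * (u 0 i - u 0 j).
Proof.
rewrite /dot; under eq_bigr do
  rewrite shift_alongE mulrDr mulrCA mulrBr ![u 0 _ * _%:R]mulrC.
by rewrite big_split -mulr_sumr sumrB !sum_eq_ord.
Qed.

Lemma H0_shift_along s i j x : H0 x -> H0 (shift_along s i j x).
Proof.
move=> Hx; have := dot_shift_along s i j x (const_mx 1).
rewrite /dot !mxE subrr mulr0 addr0.
under eq_bigr do rewrite mxE mul1r.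
by under [X in _ = X -> _]eq_bigr do rewrite mxE mul1r; rewrite Hx.
Qed.

(** Mass is moved from j to i until i is full or j is empty; s is the smaller of the two margins.
    This serves both the reduction to vertices and the exchange argument for maximal points. *)
Lemma exists_shift x i j : box_slice x -> i != j ->
    x 0 i + c < w i -> 0 < x 0 j + c ->
  exists s, [/\ 0 < s, box_slice (shift_along s i j x) &
    (i \notin inner (shift_along s i j x)) || (j \notin inner (shift_along s i j x))].
Proof.
move=> Px ij xi xj.
pose s := Num.min (w i - (x 0 i + c)) (x 0 j + c).
have s1 : s <= w i - (x 0 i + c) by rewrite ge_min lexx.
have s2 : s <= x 0 j + c by rewrite ge_min lexx orbT.
have s_gt0 : 0 < s by rewrite lt_min subr_gt0 xi.
have ji : (j == i) = false by rewrite eq_sym (negPf ij).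
have sE : s = w i - (x 0 i + c) \/ s = x 0 j + c.
  by rewrite /s /Num.min; case: ifP; [left|right].
clearbody s; exists s; split => //.
  split=> [|k]; first by apply: H0_shift_along; case: Px.
  have := box_lo k Px; have := box_hi k Px; rewrite shift_alongE => hi lo.
  have [kE|ki] := eqVneq k i.
    by move: hi lo; rewrite kE (negPf ij) /= => hi lo; lra.
  have [kE|kj] := eqVneq k j.
    by move: hi lo; rewrite kE /= => hi lo; lra.
  by rewrite /=; lra.
rewrite !inE !shift_alongE !eqxx ji (negPf ij) -negb_and.
by apply/negP => /andP[/andP[_ h1] /andP[h2 _]]; move: h1 h2; case: sE => -> /=; lra.
Qed.

Lemma inner_shift_sub s i j x : i \in inner x -> j \in inner x ->
  inner (shift_along s i j x) \subset inner x.
Proof.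
move=> ix jx; apply/fintype.subsetP => k.
have [->//|ki] := eqVneq k i; have [->//|kj] := eqVneq k j.
by rewrite !inE shift_alongE (negPf ki) (negPf kj) subrr mulr0 addr0.
Qed.

Lemma exists_shift_inner x i j : box_slice x -> i != j ->
    i \in inner x -> j \in inner x ->
  exists s, [/\ 0 < s, box_slice (shift_along s i j x) &
    (#|inner (shift_along s i j x)| < #|inner x|)%N].
Proof.
move=> Px ij ix jx.
have [||s [s_gt0 Ps out]] := exists_shift Px ij.
- by move: ix; rewrite inE => /andP[].
- by move: jx; rewrite inE => /andP[].
exists s; split => //; apply: fintype.proper_card.
rewrite fintype.properE inner_shift_sub //=; apply/fintype.subsetPn.
by case/orP: out => out; [exists i | exists j].
Qed.

(** The intersection of H_0 with a line along an edge of the box: the coordinate [p.2] is free and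
    solved from the zero sum, the others sit at their upper end on [p.1] and at their lower end
    elsewhere. There are finitely many such points. *)
Definition edge_point (p : {set 'I_n} * 'I_n) : 'rV[R]_n :=
  let f j := (if j \in p.1 then w j else 0) - c in
  \row_j (if j == p.2 then - \sum_(k | k != p.2) f k else f j).

Definition box_vertices : set 'rV[R]_n :=
  box_slice `&` edge_point @` [set: {set 'I_n} * 'I_n].

Lemma box_vertices_finite : finite_set box_vertices.
Proof.
by apply: sub_finite_set (finite_image edge_point (@finite_finset _ setT)) => x [].
Qed.

Lemma edge_pointP x i : box_slice x -> inner x \subset [set i]%SET ->
  box_vertices x.
Proof.
move=> Px /fintype.subsetP xi; split => //.
exists ([set j | x 0 j + c == w j]%SET, i) => //.
have extreme j : j != i ->
    (if j \in [set j | x 0 j + c == w j]%SET then w j else 0) - c = x 0 j.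
  move=> ji; have := box_lo j Px; have := box_hi j Px.
  have := contra (xi j); rewrite !inE => /(_ ji).
  rewrite negb_and -!leNgt; case: eqVneq => [<- _ _ _|/eqP xj]; first by rewrite addrK.
  by move=> /orP[h1 h2 h3|h1 h2 h3]; [lra|case: xj; lra].
apply/rowP => j; rewrite mxE; case: eqVneq => [->|] /=; last exact: extreme.
under eq_bigr do rewrite extreme //.
have [/eqP Hx _] := Px; move: Hx.
by rewrite (bigD1 i) //= addr_eq0 => /eqP ->.
Qed.

(* A point with two coordinates i, j strictly inside the box lies between two
   points, along e_i - e_j, that have fewer such coordinates. *)
Lemma box_slice_hull (n_gt0 : (0 < n)%N) : box_slice = conv_hull box_vertices.
Proof.
apply/seteqP; split => [x|x]; last first.
  move=> [m [v [d [Gv d_ge0 d1 ->]]]].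
  split=> [|i].
    apply: big_ind => [|y z|k _]; last by apply: H0Z; have [[]] := Gv k.
      by rewrite /H0 /= big1 // => i _; rewrite mxE.
    exact: H0D.
  rewrite summxE -[c]mul1r -[w i]mul1r -d1 !mulr_suml -big_split /=.
  rewrite sumr_ge0 /= ?ler_sum // => k _; rewrite mxE -mulrDr.
    by rewrite ler_wpM2l // box_hi //; have [] := Gv k.
  by rewrite mulr_ge0 // box_lo //; have [] := Gv k.
have [m] := ubnP #|inner x|; elim: m x => // m IH x xm Px.
have [/cards1P[i xi]|] := boolP (#|inner x| == 1%N).
  by apply/sub_conv_hull/(edge_pointP (i := i)) => //; rewrite xi.
have [x0 _|/finset.set0Pn[i ix]] := boolP (inner x == finset.set0).
  apply/sub_conv_hull/(edge_pointP (i := Ordinal n_gt0)) => //.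
  by rewrite (eqP x0) finset.sub0set.
rewrite (cardsD1 i) ix eqSS cards_eq0 => /finset.set0Pn[j].
rewrite !inE => /andP[ji jx].
have {}jx : j \in inner x by rewrite inE.
have ij : i != j by rewrite eq_sym.
have [r [r_gt0 Pr r_lt]] := exists_shift_inner Px ij ix jx.
have [s [s_gt0 Ps s_lt]] := exists_shift_inner Px ji jx ix.
(* The two shifts have opposite directions and lengths r and s, so the weights proportional to s and
   r cancel them. *)
have -> : x = s / (r + s) *: shift_along r i j x + r / (r + s) *: shift_along s j i x.
  apply/rowP => k; rewrite !mxE; field.
  by rewrite gt_eqF // addr_gt0.
apply: conv_hull_convex.
- by rewrite divr_ge0 // ltW // addr_gt0.
- by rewrite divr_ge0 // ltW // addr_gt0.
- by rewrite -mulrDl addrC divff // gt_eqF // addr_gt0.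
- by apply: IH Pr; apply: leq_trans r_lt _.
- by apply: IH Ps; apply: leq_trans s_lt _.
Qed.

(** * Faces of the box slice and their normal cones *)

Definition pinned A1 A2 z : Prop :=
  [/\ box_slice z, forall i, i \in A1 -> z 0 i + c = w i
    & forall i, i \in A2 -> z 0 i + c = 0].

(** Complementary slackness: z is at its upper end where u must be at least t, and at its lower end
    where u must be at most t. *)
Lemma pinned_term A1 A2 t u z y i : level_cone A1 A2 t u -> pinned A1 A2 z ->
  box_slice y -> 0 <= (u 0 i - t) * (z 0 i - y 0 i).
Proof.
move=> /(_ i)[u1 u2 u3] [Pz z1 z2] Py.
have [iA1|iA1] := boolP (i \in A1).
  have := u1 iA1; have := z1 i iA1; have := box_hi i Py => ? ? ?.
  by apply: mulr_ge0; lra.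
have [iA2|iA2] := boolP (i \in A2).
  have := u2 iA2; have := z2 i iA2; have := box_lo i Py => ? ? ?.
  by apply: mulr_le0; lra.
by rewrite u3 // subrr mul0r.
Qed.

Lemma dot_diff t u z y : box_slice z -> box_slice y ->
  dot u z - dot u y = \sum_i (u 0 i - t) * (z 0 i - y 0 i).
Proof.
move=> [Hz _] [Hy _]; rewrite !(dot_shift t) // -sumrB.
by apply: eq_bigr => i _; rewrite mulrBr.
Qed.

Lemma pinned_max A1 A2 t u z :
  level_cone A1 A2 t u -> pinned A1 A2 z -> max_face box_slice u z.
Proof.
move=> ut zA; have [Pz _ _] := zA; split=> // y Py.
rewrite -subr_ge0 (dot_diff t) //; apply: sumr_ge0 => i _.
exact: pinned_term ut zA Py.
Qed.

(** If x is maximal as well, the nonnegative terms of u(z) - u(x) sum to zero, so x agrees with z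
    wherever u_i differs from t, in particular on A1 and A2. *)
Lemma max_pinned A1 A2 t u z x : strict_level_cone A1 A2 t u ->
  pinned A1 A2 z -> max_face box_slice u x -> pinned A1 A2 x.
Proof.
move=> ut zA [Px xmax]; have [Pz z1 z2] := zA.
have term_ge0 i := pinned_term i (strict_level_coneW ut) zA Px.
have : \sum_i (u 0 i - t) * (z 0 i - x 0 i) == 0.
  by rewrite eq_le sumr_ge0 // andbT -dot_diff // subr_le0 xmax.
rewrite psumr_eq0 // => /allP term0.
have xz i : u 0 i != t -> x 0 i = z 0 i.
  move=> uit; have := term0 i (mem_index_enum i).
  by rewrite /= mulf_eq0 !subr_eq0 (negPf uit) /= => /eqP.
split => // i iA; have [u1 u2 _] := ut i.
  by rewrite xz ?z1 // gt_eqF ?u1.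
by rewrite xz ?z2 // lt_eqF ?u2.
Qed.

(** Otherwise moving mass from j to i would increase u. *)
Lemma max_shift_le u z i j : max_face box_slice u z -> i != j ->
  z 0 i + c < w i -> 0 < z 0 j + c -> u 0 i <= u 0 j.
Proof.
move=> [Pz zmax] ij zi zj.
have [s [s_gt0 Ps _]] := exists_shift Pz ij zi zj.
have := zmax _ Ps; rewrite dot_shift_along gerDl pmulr_rle0 //.
by rewrite subr_le0.
Qed.

(** The inner coordinate b can both give and receive mass, so comparing each i with b by exchange
    shows that u_b is the level. *)
Lemma inner_level_cone A1 A2 u z b : pinned A1 A2 z ->
    (forall i, i \notin A1 -> i \notin A2 -> i \in inner z) ->
    b \in inner z -> max_face box_slice u z ->
  level_cone A1 A2 (u 0 b) u.
Proof.
move=> [Pz z1 z2] zin; rewrite inE => /andP[b0 b1] zmax i.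
have [->|ib] := eqVneq i b; first by split.
have bi : b != i by rewrite eq_sym.
split=> [iA|iA|iA1 iA2].
- by apply: max_shift_le zmax bi b1 _; rewrite z1.
- by apply: max_shift_le zmax ib _ b0; rewrite z2.
- have := zin i iA1 iA2; rewrite inE => /andP[i0 i1].
  by apply/le_anti/andP; split; [apply: (max_shift_le zmax) | apply: (max_shift_le zmax)].
Qed.

Lemma exists_pinned A1 A2 : (A1 :&: A2 = finset.set0)%SET ->
    weight w A1 < n%:R * c -> n%:R * c < weight w (~: A2)%SET ->
  exists2 z, pinned A1 A2 z &
    (forall i, i \notin A1 -> i \notin A2 -> i \in inner z) /\
    exists b, b \in inner z.
Proof.
move=> dis lo hi.
have notin2 i : i \in A1 -> (i \in A2) = false.
  move=> iA1; apply/negP => iA2.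
  by move/finset.setP/(_ i): dis; rewrite !inE iA1 iA2.
(* Off A1 and A2 every coordinate is filled to the same fraction l of w_i. The total is q exactly
   for this l, and the two strict inequalities put l strictly between 0 and 1. *)
pose l := (n%:R * c - weight w A1) / (weight w (~: A2)%SET - weight w A1).
have D_gt0 : 0 < weight w (~: A2)%SET - weight w A1 by lra.
have l_gt0 : 0 < l by rewrite divr_gt0 // subr_gt0.
have l_lt1 : l < 1 by rewrite ltr_pdivrMr // mul1r ltrD2r.
pose f i := if i \in A1 then w i else if i \in A2 then 0 else l * w i.
have sumf : \sum_i f i = n%:R * c.
  have -> : n%:R * c =
      weight w A1 + l * (weight w (~: A2)%SET - weight w A1).
    by rewrite divfK ?gt_eqF // addrC subrK.
  rewrite /weight [\sum_(i in A1) _]big_mkcond.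
  rewrite [\sum_(i in (~: A2)%SET) _]big_mkcond /= -sumrB mulr_sumr.
  rewrite -big_split /=; apply: eq_bigr => i _; rewrite /f inE.
  case: ifPn => [/notin2 ->|_]; first by rewrite subrr mulr0 addr0.
  by case: ifP => _ /=; rewrite subr0 ?mulr0 add0r.
pose z : 'rV[R]_n := \row_i (f i - c).
have zE i : z 0 i + c = f i by rewrite mxE subrK.
have zin i : i \notin A1 -> i \notin A2 -> i \in inner z.
  move=> /negPf i1 /negPf i2; rewrite inE zE /f i1 i2 mulr_gt0 //=.
  by rewrite -[X in _ < X]mul1r ltr_pM2r.
exists z.
  split=> [|i iA|i iA]; rewrite ?zE /f ?iA //; last first.
    by case: ifP => // /notin2; rewrite iA.
  split=> [|i].
    rewrite /H0 /=; under eq_bigr do rewrite mxE.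
    by rewrite sumrB sumf sumr_const card_ord -[c *+ n]mulr_natl subrr.
  rewrite zE /f; case: ifP => _; first by rewrite lexx ltW.
  case: ifP => _; first by rewrite lexx ltW.
  apply/andP; split; first by rewrite mulr_ge0 ?ltW.
  by rewrite ger_pMl ?ltW.
(* Some index lies off both A1 and A2, since otherwise w([n] \ A2) would be at most w(A1). *)
split=> //; have [/fintype.subsetP sub|] := boolP (~: A2 \subset A1)%SET.
  suff : weight w (~: A2)%SET <= weight w A1 by lra.
  rewrite /weight big_mkcond [leRHS]big_mkcond; apply: ler_sum => i _.
  case: ifP => [/sub -> //|_]; case: ifP => // _; exact: ltW.
case/fintype.subsetPn => b; rewrite inE => b2 b1.
by exists b; apply: zin.
Qed.

(** The maximal face of u consists of pinned points, at which every functional of the cone is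
    maximal. It also contains a point that is inner off A1 and A2, and there only functionals of the
    cone can be maximal. *)
Lemma face_cone A1 A2 t u : (A1 :&: A2 = finset.set0)%SET ->
    weight w A1 < n%:R * c -> n%:R * c < weight w (~: A2)%SET ->
    strict_level_cone A1 A2 t u ->
  max_face box_slice u !=set0 /\
  normal_cone box_slice (max_face box_slice u) = fan_cone A1 A2.
Proof.
move=> dis lo hi ut; have [z zA [zin [b bz]]] := exists_pinned dis lo hi.
have zmax := pinned_max (strict_level_coneW ut) zA.
split; first by exists z.
apply/seteqP; split => v.
  move=> [Hv sub]; apply/fan_coneP => //; split=> //; exists (v 0 b).
  exact: inner_level_cone zA zin bz (sub _ zmax).
move=> /(fan_coneP _ dis)[Hv [s vs]]; split=> // x xmax.
exact: pinned_max vs (max_pinned ut zA xmax).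
Qed.

End ThresholdPolytopal.

(** * Choice of level and quota, and the equivalence *)

(** Take for t the largest value of u whose upper level set is outside K; the least value gives [n],
    so there is one. The strict upper level set is empty or is the upper level set of the next
    larger value, hence in K. *)
Lemma exists_level (R : realType) (n : nat) (K : {set {set 'I_n}})
    (u : 'I_n -> R) : finset.set0 \in K -> finset.setT \notin K ->
  exists t, [set i | t < u i]%SET \in K /\ [set i | t <= u i]%SET \notin K.
Proof.
move=> K0 KT.
have [i0 _] : exists i0 : 'I_n, i0 \in [set: 'I_n]%SET.
  by apply/finset.set0Pn; apply: contraNneq KT => ->.
pose Q i := [set j | u i <= u j]%SET \notin K.
case: (Order.TotalTheory.arg_minP (P := xpredT) u (i0 := i0)) => // m _ mmin.
have Qm : Q m.
  rewrite /Q; congr (_ \notin K): KT.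
  by apply/finset.setP => j; rewrite !inE mmin.
case: (Order.TotalTheory.arg_maxP u Qm) => i Qi imax.
exists (u i); split => //.
have [->//|/finset.set0Pn[j]] := eqVneq [set j | u i < u j]%SET finset.set0.
rewrite inE => ij.
case: (Order.TotalTheory.arg_minP (P := fun j => u i < u j) u ij) => k ik kmin.
rewrite (_ : [set _ | _]%SET = [set j | u k <= u j]%SET).
  by apply: contraTT ik => /imax; rewrite -leNgt.
apply/finset.setP => l; rewrite !inE; apply/idP/idP => [il|].
  exact: kmin.
exact: lt_le_trans.
Qed.

(** The quota is lowered to the midpoint between the largest weight in K and q, so that no coalition
    meets it exactly. *)
Lemma generic_quota (R : realType) (n : nat) (K : {set {set 'I_n}}) :
    finset.set0 \in K -> threshold_complex R K ->
  exists (w : 'I_n -> R) (q : R), [/\ forall i, 0 < w i,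
    forall A, A \in K -> weight w A < q & forall A, A \notin K -> q < weight w A].
Proof.
move=> K0 [w [q [w_gt0 KE]]].
case: (Order.TotalTheory.arg_maxP (weight w) K0) => A0 A0K A0max.
have A0q : weight w A0 < q by have : A0 \in K by []; rewrite KE inE.
exists w, ((weight w A0 + q) / 2); split => // A AK.
  by have : weight w A <= weight w A0 := A0max A AK; lra.
by move: AK; rewrite KE inE -leNgt; lra.
Qed.

Lemma threshold_polytopal (R : realType) (n : nat) (K : {set {set 'I_n}}) :
    finset.set0 \in K -> finset.setT \notin K -> threshold_complex R K ->
  polytopal (canonical_fan (R := R) K).
Proof.
move=> K0 KT /(generic_quota K0)[w [q [w_gt0 win lose]]].
have n_gt0 : (0 < n)%N.
  rewrite lt0n; apply: contraNneq KT => n0; rewrite -(_ : finset.set0 = finset.setT) //.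
  by apply/finset.setP => i; have := ltn_ord i; rewrite [X in (_ < X)%N]n0.
pose c := q / n%:R.
have ncE : n%:R * c = q by rewrite mulrC divfK // pnatr_eq0 -lt0n.
exists (box_slice w c); split.
- exists (box_vertices w c); first exact: box_vertices_finite.
  exact: box_slice_hull.
- by move=> x [].
apply/seteqP; split => C.
  move=> [A1 [A2 [A1K A2K dis ->]]].
  (* A functional in the relative interior of the given cone selects the face whose normal cone it
     is. *)
  have [t [u Hu ut]] := exists_strict_level_cone R dis.
  have [|| F0 ncF] := @face_cone R n w c w_gt0 A1 A2 t u dis _ _ ut.
  - by rewrite ncE win.
  - by rewrite ncE lose //; move: A2K; rewrite inE.
  exists (max_face (box_slice w c) u) => //.
  by split=> //; exists u.
move=> [F [_ [u Hu ->]] <-].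
(* Conversely, splitting the coordinates of u at this level gives a pair (A1, A2) of the fan whose
   cone has u in its relative interior. *)
have [t [tK tnK]] := exists_level (fun i => u 0 i) K0 KT.
pose A1 := [set i | t < u 0 i]%SET; pose A2 := [set i | u 0 i < t]%SET.
have A2C : (~: A2)%SET = [set i | t <= u 0 i]%SET.
  by apply/finset.setP => i; rewrite !inE leNgt.
have dis : (A1 :&: A2 = finset.set0)%SET.
  by apply/finset.setP => i; rewrite !inE; apply/negP => /andP[]; lra.
have [|||_ ->] := @face_cone R n w c w_gt0 A1 A2 t u dis.
- by rewrite ncE win.
- by rewrite ncE A2C lose.
- move=> i; rewrite !inE; split => //; rewrite -!leNgt => h1 h2.
  by apply/le_anti/andP.
by exists A1, A2; split => //; rewrite inE A2C.
Qed.

Theorem theorem1p1 (R : realType) (n : nat) (K : {set {set 'I_n}})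
    (K_complex : simplicial_complex K)
    (K_proper : K <> [set: {set 'I_n}]%SET)
    (K_vert : forall i : 'I_n, [set i]%SET \in K) :
  (threshold_complex R K <-> weighted_majority_game R (~: K)%SET) /\
  (threshold_complex R K <-> polytopal (@canonical_fan R n K)).
Proof.
have [K0 K_sub] := K_complex.
have KT : [set: 'I_n]%SET \notin K.
  apply/negP => KT; apply: K_proper; apply/finset.setP => A.
  by rewrite finset.in_setT (K_sub _ _ KT) ?finset.subsetT.
split; last first.
  split; first exact: threshold_polytopal.
  by move=> [P [_ PH0 fanP]]; apply: polytopal_threshold PH0 fanP.
split=> -[w [q [w_gt0 KE]]]; exists w, q; split=> //.
  by apply/finset.setP => A; rewrite KE !inE leNgt.
by rewrite -[K]finset.setCK KE; apply/finset.setP => A; rewrite !inE ltNge.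
Qed.
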